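(* Let $(W,S)$ and $(W',S)$ be finite Coxeter systems with the same set $S$ of simple generators such that $m'(r,s)\le m(r,s)$ for each pair $r,s\in S$, where $m(r,s)$ and $m'(r,s)$ denote the order of $rs$ in $W$ and in $W'$ respectively. For each $\{r,s\}\subseteq S$, fix a surjective lattice homomorphism $\eta_{\{r,s\}}$ from the weak order on $W_{\{r,s\}}$ to the weak order on $W'_{\{r,s\}}$ with $\eta_{\{r,s\}}(r)=r$ and $\eta_{\{r,s\}}(s)=s$. Then there is at most one lattice homomorphism $\eta:W\to W'$ (between weak orders) such that the restriction of $\eta$ to $W_{\{r,s\}}$ equals $\eta_{\{r,s\}}$ for each pair $r,s\in S$.
   Context: For a finite Coxeter system $(W,S)$ with length function $\ell$, the (right) weak order on $W$ is the lattice whose cover relations are $w\lessdot ws$ for $w\in W$, $s\in S$ with $\ell(w)<\ell(ws)$. A lattice homomorphism preserves pairwise meets and joins. For $J\subseteq S$, $W_J$ is the standard parabolic subgroup of $W$ generated by $J$ (a lower interval in the weak order, carrying its own weak order), and $W'_J$ is the corresponding subgroup of $W'$. *)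

(* Defs.v *)
From HB Require Import structures.
From mathcomp Require Import all_boot all_order all_fingroup.
Set Implicit Arguments.
Unset Strict Implicit.
Unset Printing Implicit Defensive.
Import Order.TTheory GroupScope.

(* The order m(r, s) of the product of two generators. *)
Definition coxeter_m (S : finType) (W : finGroupType) (gen : S -> W)
  (r s : S) : nat := #[gen r * gen s].

(* S is embedded in W as a generating set of involutions, and W has the
   presentation < S | (rs)^m(r,s) = 1 >, stated as the universal property of
   that presentation among all groups, finite or not. The relations with r = s
   are s^2 = 1. *)
Definition coxeter_system (S : finType) (W : finGroupType) (gen : S -> W) :
    Prop :=
  [/\ injective gen,
      forall s, #[gen s] = 2,
      <<[set gen s | s : S]>> = [set: W]
    & forall (H : groupType) (f : S -> H),
        (forall r s, (f r * f s) ^+ coxeter_m gen r s = 1) ->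
        exists2 phi : W -> H,
          {morph phi : x y / x * y} & forall s, phi (gen s) = f s].

Definition parabolic (S : finType) (W : finGroupType) (gen : S -> W)
  (J : {set S}) : {group W} := <<[set gen s | s in J]>>%G.

(* J as a family of generators of the group W_J. *)
Definition parabolic_gen (S : finType) (W : finGroupType) (gen : S -> W)
  (J : {set S}) (s : {s : S | s \in J}) : subg_of (parabolic gen J) :=
  subg (parabolic gen J) (gen (val s)).

Section Length.
Variables (S : finType) (W : finGroupType) (gen : S -> W).

Definition has_word_of_size (w : W) (n : nat) : bool :=
  [exists t : n.-tuple S, w == \prod_(s <- t) gen s].

Lemma length_ex (w : W) :
  exists n, (w \in <<[set gen s | s : S]>>) ==> has_word_of_size w n.
Proof.
case: (boolP (w \in _)) => [/gen_prodgP[n [c cS ->]]|_]; last by exists 0.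
have cP i : exists s, c i == gen s.
  by have /imsetP[s _ ->] := cS i; exists s.
exists n; apply/existsP; exists [tuple xchoose (cP i) | i < n].
rewrite big_tuple; apply/eqP/eq_bigr => i _.
by rewrite tnth_mktuple; apply/eqP/(xchooseP (cP i)).
Qed.

(* The value is 0 outside the subgroup generated by S, hence a genuine minimal
   word length whenever S generates. *)
Definition length (w : W) : nat := ex_minn (length_ex w).

Definition weak_cover : rel W :=
  fun u v => [exists s, (v == u * gen s) && (length u < length v)].

Lemma weak_connect_length u v :
  connect weak_cover u v -> (u == v) || (length u < length v).
Proof.
case/connectP=> p; elim: p u => [|x p IHp] u /=; first by move=> _ ->; rewrite eqxx.
case/andP=> /existsP[s /andP[_ ux]] /IHp{}IHp /IHp/orP[/eqP <-|xv].
  by rewrite ux orbT.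
by rewrite (ltn_trans ux xv) orbT.
Qed.

Lemma weak_connect_anti : antisymmetric (connect weak_cover).
Proof.
move=> u v /andP[/weak_connect_length/orP[/eqP // | uv]].
case/weak_connect_length/orP=> [/eqP // | vu].
by have := ltn_trans uv vu; rewrite ltnn.
Qed.

End Length.

(* The elements of W, ordered by the right weak order. *)
Definition weak_order (S : finType) (W : finGroupType) (gen : S -> W) : Type :=
  W.

Fact weak_display : Order.disp_t. Proof. exact: Order.Disp tt tt. Qed.

HB.instance Definition _ (S : finType) (W : finGroupType) (gen : S -> W) :=
  Finite.copy (weak_order gen) W.
HB.instance Definition _ (S : finType) (W : finGroupType) (gen : S -> W) :=
  Order.Le_isPOrder.Build weak_display (weak_order gen)
    (@connect0 W (weak_cover gen)) (@weak_connect_anti S W gen)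
    (@connect_trans W (weak_cover gen)).

Section LatticeHom.
Local Open Scope order_scope.

Definition is_meet d (T : porderType d) (x y m : T) : Prop :=
  forall z, (z <= m) = (z <= x) && (z <= y).

Definition is_join d (T : porderType d) (x y j : T) : Prop :=
  forall z, (j <= z) = (x <= z) && (y <= z).

(* Meets and joins are characterised by their universal property, so that the
   weak order need not be equipped with a latticeType structure. Between
   lattices this is preservation of binary meets and joins. *)
Definition lattice_hom d d' (T : porderType d) (T' : porderType d')
    (f : T -> T') : Prop :=
  (forall x y m, is_meet x y m -> is_meet (f x) (f y) (f m)) /\
  (forall x y j, is_join x y j -> is_join (f x) (f y) (f j)).

End LatticeHom.

(* Main.v *)
Require Import Defs.
From HB Require Import structures.
From mathcomp Require Import all_boot all_order all_fingroup.
From mathcomp Require Import zify.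
Import Order.TTheory GroupScope.

(* The weak order on W is generated, as a lattice, by its standard parabolic
   subgroups of rank two, so homomorphisms that agree on these agree everywhere.
   By induction on length, an element w with two right descents s, t is the join
   of ws and wt. Suppose that t is the only right descent of w, that s is an
   ascent, and that w is not in W_{s,t}. Write the longest element as z v0 with
   z in W_{s,t} and v0 minimal in its coset. Then l(w v0) < l(w) + l(v0), since
   otherwise w would be a suffix of z. Hence some prefix v r of a reduced word of
   v0 satisfies l(wv) = l(w) + l(v) and l(wvr) < l(wv), and by the exchange
   condition w = u x v1 is reduced with wvr = u v1 v. The join of the shorter
   elements u x and u v1 lies above w and below wv, hence not above ws, because s
   is not a left descent of v. As s varies, the meet of these joins is w. *)

(* Plain lia does not identify the lengths of group elements that differ only in
   the inferred group structure. *)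
Ltac length_lia :=
  repeat match goal with H : context [length _ _] |- _ => revert H end;
  repeat match goal with |- context [length ?g ?x] =>
    let n := fresh "n" in set n := (length g x); clearbody n end;
  intros; lia.

Section Exchange.
Set Implicit Arguments.
Unset Strict Implicit.
Unset Printing Implicit Defensive.
Variables (S : finType) (W : finGroupType) (gen : S -> W).
Hypothesis cox : coxeter_system gen.

Local Notation l := (length gen).
Local Notation wd c := (\prod_(i <- c) gen i).

(** * Words and length *)

Lemma wd_cat c1 c2 : wd (c1 ++ c2) = wd c1 * wd c2.
Proof. exact: big_cat. Qed.

Lemma wd_cons s c : wd (s :: c) = gen s * wd c.
Proof. exact: big_cons. Qed.

Lemma gen_sq s : gen s * gen s = 1.
Proof. by case: cox => _ /(_ s) o2 _ _; rewrite -expg2 -o2 expg_order. Qed.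

Lemma genV s : (gen s)^-1 = gen s.
Proof. by apply: (mulgI (gen s)); rewrite mulgV gen_sq. Qed.

Lemma gen_mulK s x : gen s * (gen s * x) = x.
Proof. by rewrite mulgA gen_sq mul1g. Qed.

Lemma wd_rev c : wd (rev c) = (wd c)^-1.
Proof.
elim: c => [|s c IH]; first by rewrite !big_nil invg1.
by rewrite rev_cons -cats1 wd_cat wd_cons big_nil mulg1 IH wd_cons invMg genV.
Qed.

Lemma length_word w : exists2 c, wd c = w & size c = l w.
Proof.
rewrite /length; case: ex_minnP => n + _.
case: cox => _ _ -> _; rewrite inE /= => /existsP[t /eqP ->].
by exists t => //; rewrite size_tuple.
Qed.

Lemma length_wd c : l (wd c) <= size c.
Proof.
rewrite /length; case: ex_minnP => n _; apply; apply/implyP => _.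
by apply/existsP; exists (in_tuple c).
Qed.

Lemma length1 : l 1 = 0.
Proof. by have := length_wd [::]; rewrite big_nil leqn0 => /eqP. Qed.

Lemma length0 w : l w = 0 -> w = 1.
Proof.
by have [c <- <-] := length_word w; move/size0nil->; rewrite big_nil.
Qed.

Lemma lengthM x y : l (x * y) <= l x + l y.
Proof.
have [c <- <-] := length_word x; have [d <- <-] := length_word y.
by rewrite -wd_cat -size_cat length_wd.
Qed.

Lemma length_gen s : l (gen s) <= 1.
Proof. by have := length_wd [:: s]; rewrite big_seq1. Qed.

Lemma reduced_tail s c : size (s :: c) = l (wd (s :: c)) -> size c = l (wd c).
Proof.
rewrite wd_cons /= => eq_sz; have := length_wd c; have := length_gen s.
by have := lengthM (gen s) (wd c); length_lia.
Qed.

Lemma lengthV x : l x^-1 = l x.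
Proof.
suff le y : l y^-1 <= l y by apply/eqP; rewrite eqn_leq le -{1}[x]invgK le.
by have [c <- <-] := length_word y; rewrite -wd_rev -(size_rev c) length_wd.
Qed.

(** * Parities of reflections and the exchange condition *)

(* The parity of the number of occurrences of x among the reflections
   s1 .. s_(i-1) s_i s_(i-1) .. s1 of the word c = s1 .. sn. *)
Fixpoint refl_parity (c : seq S) (x : W) : bool :=
  if c is s :: c' then (x == gen s) (+) refl_parity c' (x ^ gen s) else false.

Lemma refl_parity_cat c1 c2 x :
  refl_parity (c1 ++ c2) x = refl_parity c1 x (+) refl_parity c2 (x ^ wd c1).
Proof.
elim: c1 x => [|s c IH] x; first by rewrite big_nil conjg1.
by rewrite /= IH wd_cons conjgM addbA.
Qed.

(** The permutation representation on signed reflections, extended to all pairs in [W * bool]. Along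
    a word, the sign component records [refl_parity]. *)
Definition refl_step (s : S) (p : W * bool) : W * bool :=
  (p.1 ^ gen s, p.2 (+) (p.1 == gen s)).

Lemma refl_stepK s : involutive (refl_step s).
Proof.
case=> x e; rewrite /refl_step /= -conjgM gen_sq conjg1.
rewrite -(inj_eq (conjg_inj (gen s)) x) [gen s ^ _]conjgE mulKg.
by rewrite -addbA addbb addbF.
Qed.

Definition refl_perm s : {perm W * bool} := perm (inv_inj (refl_stepK s)).

Lemma refl_perm_word c x e :
  (\prod_(i <- c) refl_perm i) (x, e) = (x ^ wd c, e (+) refl_parity c x).
Proof.
elim: c x e => [|s c IH] x e; first by rewrite !big_nil perm1 conjg1 addbF.
by rewrite !big_cons permM permE IH /= conjgM addbA.
Qed.

(** The reflections met along [(rs)^k] are the [b^i r] with [b = rs] and [i < 2k], because [r]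
    inverts [b]. *)
Lemma refl_parity_pairs r s k x :
  refl_parity (flatten (nseq k [:: r; s])) x =
  \big[addb/false]_(i < k.*2) (x == (gen r * gen s) ^+ i * gen r).
Proof.
set b := gen r * gen s.
have rb i : gen r * b ^- i = b ^+ i * gen r.
  have br : gen r * b^-1 = b * gen r by rewrite invMg !genV mulgA.
  elim: i => [|i IH]; first by rewrite invg1 mulg1 mul1g.
  by rewrite expgS invMg mulgA IH -mulgA br mulgA -expgSr expgS.
have wdk i : wd (flatten (nseq i [:: r; s])) = b ^+ i.
  elim: i => [|i IH]; first by rewrite big_nil.
  by rewrite /= !wd_cons IH mulgA -expgS.
have conj_eq i y : (x ^ b ^+ i == y) = (x == b ^+ i * y * b ^- i).
  rewrite -(inj_eq (conjg_inj (b ^+ i)) x) [(b ^+ i * _ * _) ^ _]conjgE.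
  by rewrite mulgKV mulKg.
elim: k => [|k IH]; first by rewrite big_ord0.
rewrite -addn1 nseqD flatten_cat refl_parity_cat IH wdk addn1 doubleS.
(* The last pair of letters adds the reflections [b^(2k) r] and [b^(2k+1) r]. *)
rewrite !big_ord_recr /= -addbA addbF; congr (_ (+) (_ (+) _)).
  by rewrite conj_eq -mulgA rb mulgA -expgD addnn.
rewrite -conjgM -(inj_eq (conjg_inj (gen r))) -conjgM.
rewrite -mulgA gen_sq mulg1 conj_eq conjgE genV.
have -> : b ^+ k * (gen r * (gen s * gen r)) * b ^- k = b ^+ k.*2.+1 * gen r.
  rewrite -!mulgA rb (mulgA (gen r)) -/b (mulgA b) -expgS (mulgA (b ^+ k)).
  by rewrite -expgD addnS addnn.
by [].
Qed.

(** Since [b = rs] satisfies [b^m = 1], the indices [i] and [i + m] give the same reflection, so the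
    [2m] terms cancel in pairs. *)
Lemma refl_perm_rel r s :
  (refl_perm r * refl_perm s) ^+ coxeter_m gen r s = 1.
Proof.
set m := coxeter_m gen r s.
have -> k : (refl_perm r * refl_perm s) ^+ k
    = \prod_(i <- flatten (nseq k [:: r; s])) refl_perm i.
  elim: k => [|k IH]; first by rewrite big_nil.
  by rewrite expgS IH /= !big_cons mulgA.
have bm : (gen r * gen s) ^+ m = 1 by rewrite expg_order.
have wdk i : wd (flatten (nseq i [:: r; s])) = (gen r * gen s) ^+ i.
  elim: i => [|i IH]; first by rewrite big_nil.
  by rewrite /= !wd_cons IH mulgA -expgS.
apply/permP => -[x e]; rewrite refl_perm_word perm1 wdk bm conjg1; congr (_, _).
rewrite refl_parity_pairs -addnn big_split_ord /=.
rewrite [X in _ (+) (_ (+) X)](eq_bigr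
  (fun i : 'I_m => x == (gen r * gen s) ^+ i * gen r)).
  by rewrite addbb addbF.
by move=> i _; rewrite expgD bm mul1g.
Qed.

(** By the universal property of the presentation, [refl_perm] extends to a homomorphism on [W], so
    a word acts through its product alone. *)
Lemma refl_parity_eq c c' x : wd c = wd c' -> refl_parity c x = refl_parity c' x.
Proof.
case: cox => _ _ _ /(_ _ refl_perm refl_perm_rel)[phi phiM phis] eq_c.
have phi1 : phi 1 = 1 by apply: (mulgI (phi 1)); rewrite -phiM !mulg1.
have phiw d : phi (wd d) = \prod_(i <- d) refl_perm i.
  by rewrite (big_morph phi phiM phi1); apply: eq_bigr => i _; rewrite phis.
have := refl_perm_word c x false; rewrite -phiw eq_c phiw refl_perm_word.
by case.
Qed.

(** An odd count is nonzero, so [x] is a prefix times the next letter times the inverse of the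
    prefix; multiplying by [x] deletes that letter. *)
Lemma refl_parity_delete c x : refl_parity c x ->
  exists c1 a c2, c = c1 ++ a :: c2 /\ x * wd c = wd (c1 ++ c2).
Proof.
elim: c x => [//|s c IH] x /=.
have [-> _|_ /= /IH[c1 [a [c2 [-> eq_x]]]]] := eqVneq x (gen s).
  by exists [::], s, c; rewrite wd_cons gen_mulK.
exists (s :: c1), a, c2; split=> //.
by rewrite /= !wd_cons -eq_x conjgE genV !mulgA gen_sq mul1g.
Qed.

(** If the count of [gen s] in [c] is even, it is odd in [s :: c], hence in a reduced word of
    [gen s * wd c]; deleting a letter there makes [wd c] the shorter element. *)
Lemma exchangeL s c : l (gen s * wd c) <= l (wd c) ->
  exists c1 a c2, c = c1 ++ a :: c2 /\ gen s * wd c = wd (c1 ++ c2).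
Proof.
move=> le_l; apply: refl_parity_delete; apply: contraLR le_l => /negbTE par.
have [d eq_d <-] := length_word (gen s * wd c); rewrite -ltnNge.
have : refl_parity d (gen s).
  rewrite (@refl_parity_eq _ (s :: c)) ?wd_cons //=.
  by rewrite eqxx conjgE mulKg par.
case/refl_parity_delete=> c1 [a [c2 [eq_c]]].
rewrite eq_d gen_mulK eq_c => ->; rewrite (leq_ltn_trans (length_wd _)) //.
by rewrite !size_cat /= addnS.
Qed.

Lemma exchangeR s c : l (wd c * gen s) <= l (wd c) ->
  exists c1 a c2, c = c1 ++ a :: c2 /\ wd c * gen s = wd (c1 ++ c2).
Proof.
rewrite -lengthV -[l (wd c)]lengthV invMg genV -wd_rev.
case/exchangeL=> c1 [a [c2 [eq_c eq_w]]]; exists (rev c2), a, (rev c1); split.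
  by rewrite -[c]revK eq_c rev_cat rev_cons -cats1 -catA.
by rewrite -rev_cat wd_rev -eq_w invMg genV -wd_rev revK.
Qed.

Lemma size_delete (c1 c2 : seq S) a : size (c1 ++ a :: c2) = (size (c1 ++ c2)).+1.
Proof. by rewrite !size_cat addnS. Qed.

Lemma cat_eq_cat_cons (c d e1 e2 : seq S) x : c ++ d = e1 ++ x :: e2 ->
  (exists2 c2, c = e1 ++ x :: c2 & e2 = c2 ++ d) \/
  (exists2 d1, e1 = c ++ d1 & d = d1 ++ x :: e2).
Proof.
elim: c e1 => [|y c IH] e1 /=; first by right; exists e1.
case: e1 => [[-> <-]|z e1 [-> /IH[[c2 -> ->]|[d1 -> ->]]]].
- by left; exists c.
- by left; exists c2.
- by right; exists d1.
Qed.

(** The deleted letter lies either in a reduced word of [x] or in one of [y]. *)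
Lemma exchangeL_mul s x y : l (gen s * (x * y)) <= l (x * y) ->
  l (gen s * x) < l x \/ exists2 y', gen s * (x * y) = x * y' & l y' < l y.
Proof.
have [c <- <-] := length_word x; have [d <- <-] := length_word y.
rewrite -wd_cat => /exchangeL[e1 [a [e2 [eq_cd eq_w]]]].
have [[c2 eq_c eq_e]|[d1 eq_e eq_d]] := cat_eq_cat_cons eq_cd; last first.
  right; exists (wd (d1 ++ e2)); first by rewrite -!wd_cat eq_w eq_e -catA.
  by rewrite (leq_ltn_trans (length_wd _)) // eq_d size_delete.
left; have -> : gen s * wd c = wd (e1 ++ c2).
  by apply: (mulIg (wd d)); rewrite -!wd_cat -catA -eq_e -eq_w wd_cat mulgA.
by rewrite (leq_ltn_trans (length_wd _)) // eq_c size_delete.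
Qed.

(** Equal lengths are impossible: exchange would write [gen s * w] with fewer than [l w] letters. *)
Lemma lengthL s w : l (gen s * w) = (l w).+1 \/ l w = (l (gen s * w)).+1.
Proof.
have Hg := length_gen s.
have H1 := lengthM (gen s) w; have := lengthM (gen s) (gen s * w).
rewrite gen_mulK => H2.
suff : l (gen s * w) <> l w by length_lia.
have [c <- Hc] := length_word w => eq_l.
have /exchangeL[c1 [a [c2 [eq_c eq_w]]]] : l (gen s * wd c) <= l (wd c) by rewrite eq_l.
by have := length_wd (c1 ++ c2); rewrite -eq_w eq_l -Hc eq_c size_delete ltnn.
Qed.

Lemma lengthR s w : l (w * gen s) = (l w).+1 \/ l w = (l (w * gen s)).+1.
Proof.
have -> : w * gen s = (gen s * w^-1)^-1 by rewrite invMg invgK genV.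
by rewrite lengthV -[l w]lengthV; apply: lengthL.
Qed.

(** * The weak order as the prefix order of reduced words *)

Lemma weak_leE u v :
  connect (weak_cover gen) u v = (l v == l u + l (u^-1 * v)).
Proof.
apply/idP/eqP.
  case/connectP=> p; elim: p u => [|x p IH] u /=.
    by move=> _ ->; rewrite mulVg length1 addn0.
  case/andP=> /existsP[s /andP[/eqP-> lt_l]] /IH{}IH /IH{}IH.
  have := lengthR s u; have := lengthM u (u^-1 * v); rewrite mulKVg.
  have := lengthM (gen s) ((u * gen s)^-1 * v).
  rewrite invMg genV -mulgA gen_mulK; have := length_gen s.
  rewrite invMg genV -mulgA in IH; length_lia.
have [c eq_c <-] := length_word (u^-1 * v).
elim: c u eq_c => [|s c IH] u /=; rewrite ?big_nil ?wd_cons => eq_c len.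
  by rewrite -[v](mulKVg u) -eq_c mulg1.
have eq_c' : wd c = (u * gen s)^-1 * v by rewrite invMg genV -mulgA -eq_c gen_mulK.
have lus : l (u * gen s) = (l u).+1.
  have := lengthM (u * gen s) (wd c); rewrite eq_c' mulKVg -eq_c'.
  have := length_wd c; have := lengthR s u; length_lia.
apply: connect_trans (IH _ eq_c' _); last by length_lia.
by apply: connect1; apply/existsP; exists s; rewrite eqxx lus ltnSn.
Qed.

Local Notation "u <=w v" := (connect (weak_cover gen) u v) (at level 70).

Lemma weak_le_length u v : u <=w v -> l v = l u + l (u^-1 * v).
Proof. by rewrite weak_leE => /eqP. Qed.

Lemma weak_leI u v : l u + l (u^-1 * v) <= l v -> u <=w v.
Proof.
move=> le_l; rewrite weak_leE; apply/eqP.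
by have := lengthM u (u^-1 * v); rewrite mulKVg; length_lia.
Qed.

Lemma length_gen1 s : l (gen s) = 1%N.
Proof.
by have := lengthL s 1; have := length_gen s; rewrite mulg1 length1; length_lia.
Qed.

Lemma weak_le_gen s v : (gen s <=w v) = (l (gen s * v) < l v).
Proof.
rewrite weak_leE genV length_gen1 add1n; apply/eqP/idP => [->//|].
by have := lengthL s v; length_lia.
Qed.

(** This reduces joins of covers of [u] to joins of atoms. *)
Lemma weak_leM u y v : l (u * y) = l u + l y ->
  (u * y <=w v) = (u <=w v) && (y <=w u^-1 * v).
Proof.
move=> luy; rewrite !weak_leE invMg -mulgA.
have := lengthM u (u^-1 * v); have := lengthM y (y^-1 * (u^-1 * v)).
rewrite !mulKVg => H1 H2.
by apply/eqP/andP => [H|[/eqP H3 /eqP H4]]; [split; apply/eqP|]; length_lia.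
Qed.

Lemma weak_le_step u v : u <=w v -> u != v ->
  exists2 s, l (u * gen s) = l u + 1 & u * gen s <=w v.
Proof.
case/connectP=> -[|x p] /=; first by move=> _ ->; rewrite eqxx.
case/andP=> /existsP[s /andP[/eqP-> lt_l]] xp ->.
exists s; first by have := lengthR s u; length_lia.
by apply/connectP; exists p.
Qed.

(** * Parabolic subgroups and their cosets *)

Lemma wd_parabolic (J : {set S}) c : all (mem J) c -> wd c \in parabolic gen J.
Proof.
elim: c => [|s c IH]; first by rewrite big_nil group1.
by case/andP=> sJ /IH cJ; rewrite wd_cons groupM // mem_gen // imset_f.
Qed.

(** Letters are prepended one at a time; when the length drops, exchange deletes a letter, so no
    letter outside [J] appears. *)
Lemma parabolic_word (J : {set S}) w : w \in parabolic gen J ->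
  exists c, [/\ all (mem J) c, wd c = w & size c = l w].
Proof.
move=> Jw; have [c cJ <-] : exists2 c, all (mem J) c & wd c = w.
  have /gen_prodgP[n [f fJ ->]] := Jw.
  have fP i : exists s, (s \in J) && (f i == gen s).
    by have /imsetP[s sJ ->] := fJ i; exists s; rewrite sJ eqxx.
  exists [seq xchoose (fP i) | i <- index_enum 'I_n].
    by apply/allP => _ /mapP[i _ ->] /=; have /andP[] := xchooseP (fP i).
  rewrite big_map; apply: eq_bigr => i _.
  by have /andP[_ /eqP <-] := xchooseP (fP i).
elim: c cJ {w Jw} => [|s c IH] /=; first by exists [::]; rewrite big_nil length1.
rewrite wd_cons => /andP[sJ /IH[d [dJ <- sz_d]]].
have [lt_l|ge_l] := leqP (l (gen s * wd d)) (l (wd d)).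
  have [c1 [a [c2 [eq_d eq_w]]]] := exchangeL lt_l.
  exists (c1 ++ c2); split=> //.
    by move: dJ; rewrite eq_d !all_cat /= => /and3P[-> _ ->].
  have sz_c12 : size d = (size (c1 ++ c2)).+1 by rewrite eq_d size_delete.
  have := length_wd (c1 ++ c2); have := lengthL s (wd d); move: lt_l.
  by rewrite -sz_d eq_w; length_lia.
exists (s :: d); split; rewrite ?wd_cons //= ?sJ // sz_d.
by have := lengthL s (wd d); length_lia.
Qed.

Lemma gen_parabolic (J : {set S}) s : s \in J -> gen s \in parabolic gen J.
Proof. by move=> sJ; rewrite mem_gen // imset_f. Qed.

(** The last letter of [b] is a right descent of [a * b]; exchange in a word over [J] keeps the
    product in [W_J] after its removal, so the letter itself is in [W_J]. *)
Lemma parabolic_suffix (J : {set S}) a b : a * b \in parabolic gen J ->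
  l (a * b) = l a + l b -> b \in parabolic gen J.
Proof.
have [c <- sz_c] := length_word b; rewrite -sz_c.
elim/last_ind: c a sz_c => [|c s IH] a; first by rewrite big_nil group1.
rewrite -cats1 wd_cat big_seq1 size_cat addn1 => sz_c Jab lab.
have lc : size c = l (wd c).
  have := lengthM (wd c) (gen s); have := length_wd c; have := length_gen s.
  by rewrite -sz_c; length_lia.
have labs : l (a * wd c) <= l a + size c by rewrite lc lengthM.
have lt_l : l (a * (wd c * gen s) * gen s) <= l (a * (wd c * gen s)).
  by rewrite lab !mulgA -[X in l X]mulgA gen_sq mulg1; length_lia.
have [d [dJ eq_d _]] := parabolic_word Jab.
rewrite -eq_d in lt_l; have [d1 [x [d2 [eq_dd eq_w]]]] := exchangeR lt_l.
have Jac : a * wd c \in parabolic gen J.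
  have -> : a * wd c = wd (d1 ++ d2).
    by rewrite -eq_w eq_d !mulgA -[_ * _ * gen s]mulgA gen_sq mulg1.
  by apply: wd_parabolic; move: dJ; rewrite eq_dd !all_cat /= => /and3P[-> _ ->].
have Js : gen s \in parabolic gen J by rewrite -(groupMl _ Jac) // -mulgA.
rewrite groupM // (IH a) //.
have := lengthM (a * wd c) (gen s); rewrite -mulgA lab.
by have := length_gen s; length_lia.
Qed.

(** If [wd c] is a prefix of [z] and [s :: c] is reduced, exchange for the left descent [s] of [z]
    must delete a letter after that prefix, so [wd (s :: c)] is below [z]. *)
Lemma parabolic_max (J : {set S}) z :
    (forall s, s \in J -> gen s <=w z) ->
  forall y, y \in parabolic gen J -> y <=w z.
Proof.
move=> zJ y /parabolic_word[c [cJ <- sz_c]].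
elim: c cJ sz_c => [|s c IH] /=.
  by rewrite big_nil => _ _; apply: weak_leI; rewrite length1 invg1 mul1g.
case/andP=> sJ cJ; rewrite wd_cons => sz_c.
have lc : size c = l (wd c) by apply: (@reduced_tail s); rewrite wd_cons.
have /weak_le_length lz := IH cJ lc.
have := zJ _ sJ; rewrite weak_le_gen => lt_l.
have := ltnW lt_l; rewrite -{1 2}[z](mulKVg (wd c)) => /exchangeL_mul[|[x eq_x lt_x]].
  by rewrite -wd_cons -lc; have := length_wd (s :: c); rewrite wd_cons /=; length_lia.
apply: weak_leI; rewrite invMg genV -mulgA -(mulKVg (wd c) z) eq_x mulKg mulKVg.
by have := lengthM (gen s) (wd c); have := length_gen s; length_lia.
Qed.

(** Take [v] shortest in the coset [W_J x]. If lengths failed to add, exchange would delete a letter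
    of [v] and give a shorter element of the coset. *)
Lemma coset_decomposition (J : {set S}) x : exists z v,
  [/\ x = z * v, z \in parabolic gen J
    & forall y, y \in parabolic gen J -> l (y * v) = l y + l v].
Proof.
have [z Jz min_z] := arg_minnP (fun z => l (z^-1 * x)) (group1 (parabolic gen J)).
exists z, (z^-1 * x); split=> //; first by rewrite mulKVg.
move=> _ /parabolic_word[c [cJ <- sz_c]]; rewrite -sz_c.
elim: c cJ sz_c => [|s c IH] /=; first by rewrite big_nil mul1g.
case/andP=> sJ cJ; rewrite wd_cons => sz_c.
have lc : size c = l (wd c) by apply: (@reduced_tail s); rewrite wd_cons.
rewrite -mulgA addSn -(IH cJ lc); set v := z^-1 * x.
have [//|lt_l] := lengthL s (wd c * v).
have : l (gen s * (wd c * v)) <= l (wd c * v) by rewrite lt_l.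
case/exchangeL_mul=> [|[y eq_y lt_y]]; first by rewrite -sz_c -lc; length_lia.
have Jc := wd_parabolic cJ; have Js := gen_parabolic sJ.
have /min_z : z * ((wd c)^-1 * gen s * wd c)^-1 \in parabolic gen J.
  by rewrite groupM // groupV !groupM // groupV.
rewrite invMg invgK -!mulgA -/v eq_y mulKg; length_lia.
Qed.

(** * The weak order is a lattice *)

Lemma longest_ex : exists x0, forall y, y <=w x0.
Proof.
(* Maximal length makes every generator a left descent, so [parabolic_max] applies with [J] all of
   [S]. *)
have [x0 _ max_x0] := arg_maxnP l (erefl (xpredT (1 : W))).
exists x0 => y; apply: (@parabolic_max setT) => [s _|].
  have := max_x0 (gen s * x0) isT; have := lengthL s x0.
  by rewrite weak_le_gen; length_lia.
have : y \in <<[set gen s | s : S]>> by case: cox => _ _ -> _; rewrite inE.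
by apply/subsetP/genS/imsetS/subsetP => s; rewrite inE.
Qed.

Lemma weak_le_trans : transitive (connect (weak_cover gen)).
Proof. exact: connect_trans. Qed.

(** The join is the longest element of [W_{s,t}]: the [W_{s,t}] factor of any upper bound inherits
    the left descents [s] and [t]. *)
Lemma atom_join_ex s t : exists d, forall v,
  (d <=w v) = (gen s <=w v) && (gen t <=w v).
Proof.
have full x : gen s <=w x -> gen t <=w x -> exists z,
    [/\ z <=w x, z \in parabolic gen [set s; t], gen s <=w z & gen t <=w z].
  have [z [v [-> Jz lJ]]] := coset_decomposition [set s; t] x.
  have [Js Jt] : gen s \in parabolic gen [set s; t] /\ gen t \in parabolic gen [set s; t].
    by split; apply: gen_parabolic; rewrite !inE eqxx ?orbT.
  rewrite !weak_le_gen ![in l (gen _ * _)]mulgA !lJ ?groupM // !ltn_add2r => lt_s lt_t.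
  exists z; rewrite !weak_le_gen; split=> //.
  by apply: weak_leI; rewrite mulKg lJ.
have [x0 max_x0] := longest_ex.
have [d [_ Jd sd td]] := full x0 (max_x0 _) (max_x0 _).
exists d => v; apply/idP/andP => [dv|[sv tv]].
  by split; apply: weak_le_trans dv.
have [z [zv Jz sz tz]] := full v sv tv.
apply: weak_le_trans zv; apply: parabolic_max Jd => r.
by rewrite !inE => /orP[] /eqP->.
Qed.

(* The argument of Bjorner, Edelman and Ziegler: in a finite bounded poset it
   suffices to join any two covers of a common element. *)
Lemma join_ex x y : exists j, forall v, (j <=w v) = (x <=w v) && (y <=w v).
Proof.
have [x0 max_x0] := longest_ex.
have l_le u v : u <=w v -> l u <= l v by move/weak_le_length->; rewrite leq_addr.
suff below_join u : u <=w x -> u <=w y ->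
    exists j, forall v, (j <=w v) = (x <=w v) && (y <=w v).
  by apply: (below_join 1); apply: weak_leI; rewrite length1 invg1 mul1g.
(* Induction on the corank of a common lower bound [u]. *)
have [n] := ubnP (l x0 - l u); elim: n u x y => [//|n IH] u x y le_n ux uy.
have [<-|neq_ux] := eqVneq u x.
  exists y => v; apply/idP/andP => [yv|[]//]; split=> //.
  exact: weak_le_trans uy yv.
have [<-|neq_uy] := eqVneq u y.
  exists x => v; apply/idP/andP => [xv|[]//]; split=> //.
  exact: weak_le_trans ux xv.
have [s lus usx] := weak_le_step ux neq_ux.
have [t lut uty] := weak_le_step uy neq_uy.
have [d dP] := atom_join_ex s t.
have usP v : (u * gen s <=w v) = (u <=w v) && (gen s <=w u^-1 * v).
  by rewrite weak_leM // length_gen1.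
have utP v : (u * gen t <=w v) = (u <=w v) && (gen t <=w u^-1 * v).
  by rewrite weak_leM // length_gen1.
have lud : l (u * d) = l u + l d.
  have /weak_le_length : d <=w u^-1 * x0.
    have := max_x0 (u * gen s); have := max_x0 (u * gen t).
    by rewrite usP utP dP => /andP[_ ->] /andP[_ ->].
  have := weak_le_length (max_x0 u); have := lengthM u d.
  have := lengthM (u * d) (d^-1 * (u^-1 * x0)); rewrite -mulgA !mulKVg.
  by length_lia.
have udP v : (u * d <=w v) = (u * gen s <=w v) && (u * gen t <=w v).
  by rewrite weak_leM // dP usP utP; do 3!case: (connect _ _ _).
have usd : u * gen s <=w u * d.
  by have := udP (u * d); rewrite connect0 => /esym/andP[].
have utd : u * gen t <=w u * d.
  by have := udP (u * d); rewrite connect0 => /esym/andP[].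
have lt_n r : l (u * gen r) = l u + 1 -> l x0 - l (u * gen r) < n.
  by move=> lur; have := l_le _ _ (max_x0 (u * gen r)); move: le_n; length_lia.
(* [x'] joins [x] with [u * d] above [u * gen s]; it is then joined with [y] above [u * gen t]. *)
have [x' x'P] := IH _ _ _ (lt_n _ lus) usx usd.
have utx' : u * gen t <=w x'.
  have := x'P x'; rewrite connect0 => /esym/andP[_]; exact: weak_le_trans utd.
have [j jP] := IH _ _ _ (lt_n _ lut) utx' uty.
exists j => v; rewrite jP x'P udP.
apply/andP/andP => [[/andP[-> _] ->]//|[xv yv]]; rewrite xv yv /=.
by rewrite (weak_le_trans usx xv) (weak_le_trans uty yv).
Qed.

Lemma weak_le_anti u v : u <=w v -> l v <= l u -> u = v.
Proof.
move=> /weak_le_length luv le_l; have /length0 : l (u^-1 * v) = 0 by length_lia.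
by move/(congr1 (mulg u)); rewrite mulKVg mulg1.
Qed.

(** A longest common lower bound absorbs any other, since their join is again a common lower
    bound. *)
Lemma meet_ex x y : exists m, forall v, (v <=w m) = (v <=w x) && (v <=w y).
Proof.
have one_le v : 1 <=w v by apply: weak_leI; rewrite length1 invg1 mul1g.
have low1 : (1 <=w x) && (1 <=w y) by rewrite !one_le.
have [m /andP[mx my] max_m] :=
  @arg_maxnP _ 1 (fun v => (v <=w x) && (v <=w y)) l low1.
exists m => v; apply/idP/andP => [vm|[vx vy]].
  by split; apply: weak_le_trans vm _.
have [j jP] := join_ex m v.
have := jP j; rewrite connect0 => /esym/andP[mj vj].
rewrite (weak_le_anti mj) //; apply: max_m.
by rewrite !jP mx my vx vy.
Qed.

(** * Separating [w] from a cover by two shorter elements *)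

Lemma separation s t w : w \notin parabolic gen [set s; t] ->
    (forall r, l (w * gen r) < l w -> r = t) -> l w < l (w * gen s) ->
  exists a b, [/\ l a < l w, l b < l w,
    forall v, a <=w v -> b <=w v -> w <=w v
    & exists v, [/\ a <=w v, b <=w v & ~~ (w * gen s <=w v)]].
Proof.
move=> Jw w_desc lt_ws.
have [x0 max_x0] := longest_ex.
have [z [v0 [def_x0 Jz lJ]]] := coset_decomposition [set s; t] x0.
(* As [z * w^-1] is below [x0 = z * v0], additivity of [l (w * v0)] would make [w] a suffix of [z],
   hence an element of [W_{s,t}]. *)
have short : l (w * v0) < l w + l v0.
  rewrite ltn_neqAle lengthM andbT; apply: contra Jw => /eqP lwv0.
  apply: (@parabolic_suffix _ (z * w^-1)); rewrite mulgKV //.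
  have := weak_le_length (max_x0 (z * w^-1)).
  by rewrite invMg invgK -mulgA def_x0 mulKg lJ // lwv0; length_lia.
have l_st r : r \in [set s; t] -> l (gen r * v0) = (l v0).+1.
  by move=> /gen_parabolic/lJ->; rewrite length_gen1.
have [v [r [c [def_v0 lv0 lwv lwvr]]]] : exists v r c,
    [/\ v0 = v * gen r * wd c, l v0 = l v + 1 + size c,
        l (w * v) = l w + l v & l (w * v * gen r) <= l (w * v)].
  suff chain d v : v0 = v * wd d -> l v0 = l v + size d ->
      l (w * v) = l w + l v -> exists v r c,
    [/\ v0 = v * gen r * wd c, l v0 = l v + 1 + size c,
        l (w * v) = l w + l v & l (w * v * gen r) <= l (w * v)].
    have [d def_d sz_d] := length_word v0.
    by apply: (chain d 1); rewrite ?mul1g ?mulg1 ?length1 ?addn0.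
  elim: d v => [|r d IH] v.
    by rewrite big_nil mulg1 => <- _ lwv0; rewrite lwv0 ltnn in short.
  rewrite wd_cons mulgA => def_v lv lwv.
  have [le_l|gt_l] := leqP (l (w * v * gen r)) (l (w * v)).
    by exists v, r, d; split=> //; rewrite lv /= addnS addn1.
  apply: (IH (v * gen r)) => //; move: lv; rewrite def_v /=.
    have := lengthM (v * gen r) (wd d); have := length_wd d.
    by have := lengthR r v; length_lia.
  have := lengthM (v * gen r) (wd d); have := length_wd d.
  have := lengthR r v; have := lengthR r (w * v).
  by rewrite mulgA; length_lia.
(* [v] and [v * gen r] are prefixes of [v0], so [s] and [t] are left ascents of both. *)
have v_st q : q \in [set s; t] ->
    l (gen q * v) = (l v).+1 /\ l (gen q * (v * gen r)) = (l v).+2.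
  move/l_st; rewrite {1}def_v0 => lqv0; have := length_wd c.
  have := lengthM (gen q * (v * gen r)) (wd c); have := lengthR r (gen q * v).
  have := lengthL q v; have := lengthL q (v * gen r); have := lengthR r v.
  by move: lqv0; rewrite !mulgA; length_lia.
have lvr : l (v * gen r) = (l v).+1.
  have := lengthM (v * gen r) (wd c); rewrite -def_v0; have := length_wd c.
  by have := lengthR r v; length_lia.
have [wc def_w sz_w] := length_word w; have [vc def_v sz_v] := length_word v.
have := lwvr; rewrite -{1 2}def_w -{1 2}def_v -wd_cat.
case/exchangeR=> c1 [x [e [eq_cd eq_w]]].
(* The deleted letter is in [wc]: deleting it from [vc] would make [v * gen r] shorter than [v]. *)
have [[c2 def_wc def_e]|[d1 def_c1 def_vc]] := cat_eq_cat_cons eq_cd; last first.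
  have eq_vr : v * gen r = wd (d1 ++ e).
    apply: (mulgI w); rewrite -{2}def_w -wd_cat catA -def_c1 -eq_w wd_cat.
    by rewrite def_w def_v mulgA.
  have := length_wd (d1 ++ e); rewrite -eq_vr lvr -sz_v def_vc size_delete.
  by rewrite ltnNge ltnW.
set u := wd c1; set v1 := wd c2.
have def_w' : w = u * gen x * v1 by rewrite -def_w def_wc wd_cat wd_cons mulgA.
have sz_w' : l w = (size c1 + size c2).+1.
  by rewrite -sz_w def_wc size_cat /= addnS.
have lu : l u <= size c1 by exact: length_wd.
have lv1 : l v1 <= size c2 by exact: length_wd.
have wvr : w * v * gen r = u * v1 * v.
  by rewrite -{1}def_w -{1}def_v -wd_cat eq_w def_e !wd_cat def_v mulgA.
have lux : l (u * gen x) <= l u + 1 by rewrite -(length_gen1 x) lengthM.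
(* Only [v1 = 1] is in doubt. Then [x] is a right descent of [w], so [x = t] and
   [v * gen r = gen t * v], against [t] being a left ascent of [v * gen r]. *)
have a_lt : l (u * gen x) < l w.
  have [c2_nil|c2_ne] := posnP (size c2); last by length_lia.
  have v1_1 : v1 = 1 by rewrite /v1 (size0nil c2_nil) big_nil.
  rewrite v1_1 mulg1 in def_w' wvr.
  have x_t : x = t.
    by apply: w_desc; rewrite def_w' -mulgA gen_sq // mulg1 -def_w'; length_lia.
  have vr : v * gen r = gen t * v.
    apply: (mulgI w); rewrite mulgA wvr def_w' x_t -!mulgA.
    by rewrite (mulgA (gen t)) gen_sq // mul1g.
  have [|_] := v_st t; first by rewrite !inE eqxx orbT.
  by rewrite vr gen_mulK //; length_lia.
have luv1 : l (u * v1) = size c1 + size c2.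
  have := lengthM u v1; have := lengthM (u * v1) (v * gen r).
  have -> : u * v1 * (v * gen r) = w * v.
    by rewrite mulgA -wvr -mulgA gen_sq // mulg1.
  by length_lia.
exists (u * gen x), (u * v1); split=> //; first by rewrite luv1 sz_w'.
  move=> y /weak_le_length ay /weak_le_length b_y.
  apply: weak_leI.
  (* [x] is a left descent of [u^-1 * y], which has prefix [v1]. As [gen x * v1] is reduced,
     exchange deletes a letter after [v1], so [w] is a prefix of [y]. *)
  have : l (gen x * (v1 * (v1^-1 * (u^-1 * y)))) <= l (v1 * (v1^-1 * (u^-1 * y))).
    rewrite mulKVg; move: ay; rewrite invMg genV // -mulgA.
    have := lengthM u (u^-1 * y); rewrite mulKVg.
    by have := lengthM (u * gen x) v1; rewrite -def_w'; length_lia.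
  case/exchangeL_mul=> // [lt_l|[y' eq_y lt_y]].
    have := lengthM u (gen x * v1); rewrite mulgA -def_w'; length_lia.
  rewrite def_w' !invMg genV //.
  have -> : v1^-1 * (gen x * u^-1) * y = y'.
    by rewrite -!mulgA -(mulKVg v1 (u^-1 * y)) eq_y mulKg.
  by rewrite -def_w'; move: b_y; rewrite invMg -mulgA luv1; length_lia.
exists (w * v); split.
- apply: weak_leI; rewrite {1}def_w' -mulgA mulKg lwv.
  by have := lengthM v1 v; length_lia.
- have -> : w * v = u * v1 * (v * gen r).
    by rewrite mulgA -wvr -mulgA gen_sq // mulg1.
  apply: weak_leI; rewrite mulKg mulgA -wvr -mulgA gen_sq // mulg1 lwv.
  by length_lia.
- rewrite weak_leE invMg genV // -!mulgA mulKg lwv.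
  have [|-> _] := v_st s; first by rewrite !inE eqxx.
  by apply/eqP; length_lia.
Qed.

(** * Generation by rank two parabolic subgroups *)

Lemma weak_le_descent s w : l (w * gen s) < l w -> w * gen s <=w w.
Proof.
move=> lt_l; apply: weak_leI; rewrite invMg mulgKV genV length_gen1.
by length_lia.
Qed.

Lemma descent_ex w : w != 1 -> exists s, l (w * gen s) < l w.
Proof.
have [c <- sz_c] := length_word w; rewrite -sz_c.
case/lastP: c {sz_c} => [|c s]; first by rewrite big_nil eqxx.
move=> _; exists s; rewrite -cats1 wd_cat big_seq1 -mulgA gen_sq mulg1 size_cat addn1.
exact: length_wd.
Qed.

Theorem rank_two_generation (P : W -> Prop) :
    P 1 -> (forall s t w, w \in parabolic gen [set s; t] -> P w) ->
    (forall x y j, (forall v, (j <=w v) = (x <=w v) && (y <=w v)) ->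
       P x -> P y -> P j) ->
    (forall x y m, (forall v, (v <=w m) = (v <=w x) && (v <=w y)) ->
       P x -> P y -> P m) ->
  forall w, P w.
Proof.
move=> P1 P2 Pjoin Pmeet w.
have [n] := ubnP (l w); elim: n w => [//|n IHn] w /ltnSE le_n.
have IH x : l x < l w -> P x by move=> lt_x; apply/IHn/(leq_trans lt_x).
have [->//|/descent_ex[t lt_t]] := eqVneq w 1.
have [/existsP[r /andP[neq_rt lt_r]]|] :=
    boolP [exists r, (r != t) && (l (w * gen r) < l w)].
  have [j jP] := join_ex (w * gen t) (w * gen r).
  suff -> : w = j by apply: Pjoin jP _ _; apply: IH.
  have jw : j <=w w by rewrite jP !weak_le_descent.
  have := jP j; rewrite connect0 => /esym/andP[tj rj].
  (* A join shorter than [w] would equal both [w * gen t] and [w * gen r]. *)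
  apply/esym; apply: weak_le_anti jw _; rewrite leqNgt.
  apply: contra neq_rt => lt_j; apply/eqP.
  case: cox => gen_inj _ _ _; apply/gen_inj/(mulgI w).
  have -> : w * gen t = j.
    by apply: weak_le_anti tj _; have := lengthR t w; length_lia.
  by apply: weak_le_anti rj _; have := lengthR r w; length_lia.
rewrite negb_exists => /forallP desc_t.
have {}desc_t r : l (w * gen r) < l w -> r = t.
  by move=> lt_r; apply/eqP; have := desc_t r; rewrite lt_r andbT negbK.
have [/existsP[s /P2 //]|] := boolP [exists s, w \in parabolic gen [set s; t]].
rewrite negb_exists => /forallP Jw.
have separated s : l w < l (w * gen s) ->
    exists m, [/\ P m, w <=w m & ~~ (w * gen s <=w m)].
  case/(separation (Jw s) desc_t)=> a [b [lt_a lt_b above_w [v [av bv wsv]]]].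
  have [j jP] := join_ex a b; exists j; split.
  - by apply: Pjoin jP _ _; apply: IH.
  - by have := jP j; rewrite connect0 => /esym/andP[]; apply: above_w.
  - apply: contra wsv => wsj; apply: weak_le_trans wsj _.
    by rewrite jP av.
(* Were [t] the only generator, [w] would lie in [W_{t,t}]. An ascent [s] supplies a first [m] above
   [w]. *)
have [s neq_st] : exists s, s != t.
  apply/existsP; apply: contraNT (Jw t); rewrite negb_exists => /forallP all_t.
  have [c <- _] := length_word w; apply/wd_parabolic/allP => s _.
  by have := all_t s; rewrite negbK !inE => ->.
have [m [Pm wm _]] : exists m, [/\ P m, w <=w m & ~~ (w * gen s <=w m)].
  apply: separated; have := lengthR s w; have /contra_neqN := @desc_t s.
  by move=> /(_ neq_st); length_lia.
(* While [m] differs from [w], some cover [w * gen r] lies below [m]; the meet with an [m'] not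
   above that cover is strictly shorter. *)
have [k] := ubnP (l m); elim: k m Pm wm => [//|k IHk] m Pm wm /ltnSE le_k.
have [->//|/(weak_le_step wm)[r lwr wrm]] := eqVneq w m.
have [|m' [Pm' wm' wrm']] := separated r; first by length_lia.
have [p pP] := meet_ex m m'.
apply: (IHk p); [exact: Pmeet pP Pm Pm' | by rewrite pP wm | ].
have := pP p; rewrite connect0 => /esym/andP[pm pm'].
apply: leq_trans le_k; rewrite ltnNge; apply: contra wrm' => le_mp.
by rewrite (weak_le_trans _ pm') // (weak_le_anti pm).
Qed.

End Exchange.

(** * Uniqueness of the homomorphism *)

Lemma is_join_unique d (T : porderType d) (x y i j : T) :
  is_join x y i -> is_join x y j -> i = j.
Proof.
move=> iP jP; apply: le_anti; apply/andP; split.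
  by rewrite iP -jP.
by rewrite jP -iP.
Qed.

Lemma is_meet_unique d (T : porderType d) (x y i j : T) :
  is_meet x y i -> is_meet x y j -> i = j.
Proof.
move=> iP jP; apply: le_anti; apply/andP; split.
  by rewrite jP -iP.
by rewrite iP -jP.
Qed.

Theorem theorem1p7 (S : finType) (W W' : finGroupType)
    (gen : S -> W) (gen' : S -> W')
    (cox : coxeter_system gen) (cox' : coxeter_system gen')
    (m_le : forall r s : S, coxeter_m gen' r s <= coxeter_m gen r s)
    (eta2 : forall J : {set S},
       weak_order (@parabolic_gen S W gen J) ->
       weak_order (@parabolic_gen S W' gen' J))
    (eta2_hom : forall r s : S, lattice_hom (eta2 [set r; s]))
    (eta2_surj : forall (r s : S) (y : weak_order (@parabolic_gen S W' gen' [set r; s])),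
       exists x, eta2 [set r; s] x = y)
    (eta2_gen : forall (r s : S) (t : {t : S | t \in [set r; s]}),
       eta2 [set r; s] (parabolic_gen gen t) = parabolic_gen gen' t)
    (eta theta : weak_order gen -> weak_order gen')
    (eta_hom : lattice_hom eta) (theta_hom : lattice_hom theta)
    (eta_res : forall (r s : S) (x : subg_of (parabolic gen [set r; s])),
       eta (sgval x) = sgval (eta2 [set r; s] x))
    (theta_res : forall (r s : S) (x : subg_of (parabolic gen [set r; s])),
       theta (sgval x) = sgval (eta2 [set r; s] x)) :
  forall w : W, eta w = theta w.
Proof.
apply: (rank_two_generation cox).
(* The identity lies in [W_{r,r}] for any [r]; if [S] is empty, [W'] is trivial. *)
- have [r _|S0] := pickP S.
    exact: etrans (eta_res r r 1) (esym (theta_res r r 1)).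
  have W'1 (x : W') : x = 1.
    have [_ _ gen_W' _] := cox'.
    have : x \in <<[set gen' s | s : S]>> by rewrite gen_W' inE.
    rewrite (_ : [set gen' s | s : S] = set0) ?gen0 => [/set1P //|].
    by apply/setP=> y; rewrite inE; apply/imsetP => -[s]; have := S0 s.
  by rewrite (W'1 (eta 1)) (W'1 (theta 1)).
- move=> r s w Jw; rewrite -(subgK _ Jw).
  exact: etrans (eta_res _ _ _) (esym (theta_res _ _ _)).
- move=> x y j jP Ex Ey.
  have := eta_hom.2 x y j jP; rewrite Ex Ey => etaP.
  exact: is_join_unique etaP (theta_hom.2 x y j jP).
- move=> x y m mP Ex Ey.
  have := eta_hom.1 x y m mP; rewrite Ex Ey => etaP.
  exact: is_meet_unique etaP (theta_hom.1 x y m mP).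
Qed.
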